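(* Let $\Gamma$ be a subshift of $\Lambda^\omega$ with $\Lambda$ countable. If $\Gamma$ is a subshift of bounded type and $Z\subseteq\Gamma$ is a closed internally chain transitive set (for $\sigma$), then there exists $x\in\Gamma$ with $Z=\omega(x)$. Additionally, $x$ can be chosen such that for all $\epsilon>0$ there exists $N\in\omega$ such that $d(\sigma^i(x),Z)<\epsilon$ for all $i\ge N$.
   Context: Let $\omega=\{0,1,2,\dots\}$; ''countable'' means finite or countably infinite. $\Lambda^\omega$ is the set of infinite sequences $x=x_0x_1x_2\cdots$ over $\Lambda$, with the product topology where $\Lambda$ is discrete, metrized by $d(x,y)=\inf\{2^{-n}: x_i=y_i \text{ for all } i<n\}$; the shift map is $\sigma(x_0x_1x_2\cdots)=x_1x_2\cdots$. A subshift of $\Lambda^\omega$ is a closed set $\Gamma\subseteq\Lambda^\omega$ with $\sigma(\Gamma)=\Gamma$. A word is a finite sequence over $\Lambda$ of length at least $1$; it is allowed for $\Gamma$ if it occurs as a block of consecutive symbols (subword) of some $x\in\Gamma$, and forbidden otherwise. A basis for the forbidden words of $\Gamma$ is a set $\mathcal F$ of forbidden words such that every forbidden word contains some element of $\mathcal F$ as a subword. $\Gamma$ is a subshift of bounded type (SBT) if it has a basis for its forbidden words such that, for some $n\in\mathbb N$, every element of the basis has length less than $n$. For a point $x$, $\omega(x)=\bigcap_{N\in\omega}\overline{\{\sigma^i(x):i\ge N\}}$. For $\delta>0$, a $\delta$-chain from $a$ to $b$ is a finite sequence $x_0,x_1,\dots,x_n$ with $x_0=a$, $x_n=b$ and $d(\sigma(x_i),x_{i+1})<\delta$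 for all $i<n$. A set $A$ is internally chain transitive (ICT) if for all $a,b\in A$ and all $\delta>0$ there is a $\delta$-chain from $a$ to $b$ consisting of elements of $A$. Also $d(y,Z)=\inf_{z\in Z}d(y,z)$. *)

(* Defs.v *)
From HB Require Import structures.
From mathcomp Require Import all_boot all_order all_algebra.
From mathcomp Require Import all_classical all_reals all_analysis.

Set Implicit Arguments.
Unset Strict Implicit.
Unset Printing Implicit Defensive.

Import Order.TTheory GRing.Theory Num.Theory.

Local Open Scope classical_set_scope.
Local Open Scope ring_scope.

(* One-sided infinite sequences over the discrete alphabet L, with the product
   topology. *)
Notation infseq L := {ptws nat -> discrete_topology L}.

Definition shift_map (L : choiceType) (x : infseq L) : infseq L :=
  fun i => x i.+1.

(* The set is nonempty (n = 0) and bounded below by 0, so [inf] is a genuine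
   infimum. *)
Definition seq_dist (R : realType) (L : choiceType) (x y : infseq L) : R :=
  inf [set 2^-1 ^+ n | n in [set n : nat | forall i, (i < n)%N -> x i = y i]].

(* Only meaningful for nonempty Z: [inf set0 = 0] in the library. *)
Definition seq_dist_set (R : realType) (L : choiceType) (y : infseq L)
    (Z : set (infseq L)) : R :=
  inf [set seq_dist R y z | z in Z].

Definition subshift (L : choiceType) (G : set (infseq L)) : Prop :=
  closed G /\ @shift_map L @` G = G.

Definition word (L : choiceType) (w : seq L) : Prop := (0 < size w)%N.

Definition occurs_in (L : choiceType) (w : seq L) (x : infseq L) : Prop :=
  exists k, w = mkseq (fun i => x (k + i)%N) (size w).

Definition allowed (L : choiceType) (G : set (infseq L)) (w : seq L) : Prop :=
  word w /\ exists2 x, G x & occurs_in w x.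

Definition forbidden (L : choiceType) (G : set (infseq L)) (w : seq L) : Prop :=
  word w /\ ~ allowed G w.

Definition forbidden_basis (L : choiceType) (G : set (infseq L))
    (F : set (seq L)) : Prop :=
  F `<=` forbidden G /\
  forall w, forbidden G w -> exists2 f, F f & infix f w.

Definition bounded_type (L : choiceType) (G : set (infseq L)) : Prop :=
  exists F : set (seq L), forbidden_basis G F /\
    exists n : nat, forall w, F w -> (size w < n)%N.

Definition omega_limit (L : choiceType) (x : infseq L) : set (infseq L) :=
  \bigcap_(N in [set: nat])
    closure [set iter i (@shift_map L) x | i in [set i : nat | (N <= i)%N]].

(* The finite sequence is c 0, ..., c n; values of c beyond n are irrelevant.
   A chain makes at least one step: with n = 0 allowed, every singleton would
   be internally chain transitive, even when its point is not shift-fixed. *)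
Definition delta_chain_in (R : realType) (L : choiceType) (A : set (infseq L))
    (delta : R) (a b : infseq L) : Prop :=
  exists (n : nat) (c : nat -> infseq L),
    [/\ (0 < n)%N, c 0%N = a, c n = b,
        forall i, (i <= n)%N -> A (c i) &
        forall i, (i < n)%N -> seq_dist R (shift_map (c i)) (c i.+1) < delta].

Definition internally_chain_transitive (R : realType) (L : choiceType)
    (A : set (infseq L)) : Prop :=
  forall a b, A a -> A b ->
    forall delta : R, 0 < delta -> delta_chain_in A delta a b.

(* Main.v *)
(** Given points [z_k] of [Z] such that every finite prefix of an element of
    [Z] is a prefix of some [z_k], chains in [Z] from [z_k] to [z_(k+1)] whose
    mesh tends to 0 concatenate to a pseudo-orbit [y_0, y_1, ...] in [Z].
    A pseudo-orbit is traced by the sequence of its first symbols: if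
    [shift y_j] and [y_(j+1)] share their first [m_j] symbols, [m] nondecreasing,
    then [x_j = y_j(0)] satisfies [x_(j+i) = y_j(i)] for all [i <= m_j]. Hence
    windows of [x] of bounded length come from [Z], so [x] avoids the bounded
    basis of forbidden words, and the limit set of [x] is [Z]. *)

Require Import Defs.
From mathcomp Require Import all_boot all_order all_algebra.
From mathcomp Require Import all_classical all_reals all_analysis.

Import Order.TTheory GRing.Theory Num.Theory.

Local Open Scope classical_set_scope.
Local Open Scope ring_scope.

Set Implicit Arguments.
Unset Strict Implicit.
Unset Printing Implicit Defensive.

Definition agree {L : choiceType} (n : nat) (x y : infseq L) : Prop :=
  forall i, (i < n)%N -> x i = y i.

Section Prefixes.
Context {L : choiceType}.
Implicit Types (x y z : infseq L) (A G : set (infseq L)).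

Lemma agree_sym n x y : agree n x y -> agree n y x.
Proof. by move=> xy i /xy. Qed.

Lemma agree_trans n x y z : agree n x y -> agree n y z -> agree n x z.
Proof. by move=> xy yz i lt_in; rewrite xy ?yz. Qed.

Lemma agreeW m n x y : (m <= n)%N -> agree n x y -> agree m x y.
Proof. by move=> le_mn xy i lt_im; apply/xy/(leq_trans lt_im). Qed.

Lemma agreeP n x y : agree n x y <-> mkseq x n = mkseq y n.
Proof.
split=> [xy|eqxy i lt_in].
  by apply/eq_in_map => i; rewrite mem_iota => /andP[_]; apply: xy.
by rewrite -(nth_mkseq (x 0) x lt_in) eqxy nth_mkseq.
Qed.

Lemma iter_shiftE x j i : iter j (@shift_map L) x i = x (j + i)%N.
Proof. by elim: j i => //= j IH i; rewrite /shift_map IH addnS. Qed.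

Lemma nbhs_agree n x : nbhs x (agree n x).
Proof.
elim: n => [|n IH]; first by apply: filterS filterT => y _ i.
have xn : nbhs x [set y : infseq L | y n = x n].
  exact: (@proj_continuous _ (fun=> discrete_topology L) n x _
            (discrete_set1 (x n))).
apply: filterS (filterI IH xn) => y [xy yn] i.
by rewrite ltnS leq_eqVlt => /predU1P[->|/xy].
Qed.

Lemma nbhs_agreeE x A : nbhs x A -> exists n, agree n x `<=` A.
Proof.
pose F := filter_from [set: nat] (fun n => agree n x).
have FF : Filter F.
  apply: filter_from_filter; first by exists 0%N.
  move=> i j _ _; exists (maxn i j) => // y xy; split.
    exact: agreeW (leq_maxl _ _) xy.
  exact: agreeW (leq_maxr _ _) xy.
suff Fx : {ptws, F --> x} by move=> /Fx[n _ sub]; exists n.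
apply/pointwise_cvgP => i B /= Bx; exists i.+1 => // y xy /=.
by rewrite -(xy i) //; apply: nbhs_singleton.
Qed.

Lemma closure_agreeP A x :
  closure A x <-> forall n, exists2 y, A y & agree n x y.
Proof.
split=> [clAx n|H B /nbhs_agreeE[n sub]].
  by have [y [Ay xy]] := clAx _ (nbhs_agree n x); exists y.
by have [y Ay xy] := H n; exists y; split=> //; apply: sub.
Qed.

End Prefixes.

Section Distance.
Context {R : realType} {L : choiceType}.
Implicit Types (x y z : infseq L) (Z : set (infseq L)).

Lemma seq_dist_ge0 x y : 0 <= seq_dist R x y.
Proof.
apply: lb_le_inf; first by exists (2^-1 ^+ 0); exists 0%N.
by move=> _ [n _ <-]; rewrite exprn_ge0 ?invr_ge0.
Qed.

Lemma seq_dist_agree n x y : agree n x y -> seq_dist R x y <= 2^-1 ^+ n.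
Proof.
move=> xy; apply: ge_inf; last by exists n.
by exists 0 => _ [k _ <-]; rewrite exprn_ge0 ?invr_ge0.
Qed.

Lemma agree_seq_dist n x y : seq_dist R x y < 2^-1 ^+ n -> agree n x y.
Proof.
move=> /inf_lt[|_ [k xy <-]]; first by exists (2^-1 ^+ 0); exists 0%N.
rewrite ltr_iXn2l ?invr_gt0 ?invf_lt1 ?ltr1n // => lt_nk.
exact: agreeW (ltnW lt_nk) xy.
Qed.

Lemma seq_dist_set_le y z Z : Z z -> seq_dist_set R y Z <= seq_dist R y z.
Proof.
move=> Zz; apply: ge_inf; last by exists z.
by exists 0 => _ [? _ <-]; apply: seq_dist_ge0.
Qed.

Lemma half_expr_lt (eps : R) : 0 < eps -> exists n : nat, 2^-1 ^+ n < eps.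
Proof.
move=> eps0.
have /cvg_expr/cvgrPdist_lt/(_ _ eps0)[n _ /(_ n (leqnn n))] : `|2^-1 : R| < 1.
  by rewrite ger0_norm ?invr_ge0 // invf_lt1 // ltr1n.
by rewrite sub0r normrN ger0_norm ?exprn_ge0 ?invr_ge0 //; exists n.
Qed.

End Distance.

Lemma bounded_type_local {L : choiceType} (G : set (infseq L)) :
  subshift G -> bounded_type G ->
  exists n, forall x : infseq L,
    (forall j, exists2 y, G y & agree n (iter j (@shift_map L) x) y) -> G x.
Proof.
move=> [Gcl Gsh] [F [[Fforb Fbasis] [n Fn]]]; exists n => x xG.
have Giter j y : G y -> G (iter j (@shift_map L) y).
  elim: j => //= j IH Gy; rewrite -Gsh.
  by exists (iter j (@shift_map L) y) => //; apply: IH.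
have pre_allowed m : allowed G (mkseq x m.+1).
  apply: contrapT => nall.
  have [|f Ff /infixP[p [s def_x]]] := Fbasis (mkseq x m.+1).
    by split; rewrite // /word size_mkseq.
  have [wf] := Fforb _ Ff; apply.
  have [y Gy xy] := xG (size p); split=> //; exists y => //; exists 0%N.
  apply: (@eq_from_nth _ (x 0%N)) => [|i lt_if]; rewrite ?size_mkseq //.
  rewrite nth_mkseq // add0n -xy ?iter_shiftE; last first.
    exact: ltn_trans lt_if (Fn _ Ff).
  have lt_m : (size p + i < m.+1)%N.
    by rewrite -(size_mkseq x m.+1) def_x !size_cat ltn_add2l ltn_addr.
  rewrite -(nth_mkseq (x 0%N) x lt_m) def_x nth_cat ltnNge leq_addr /= addKn.
  by rewrite nth_cat lt_if.
apply: Gcl; apply/closure_agreeP => m.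
have [_ [y Gy [k def_x]]] := pre_allowed m.
exists (iter k (@shift_map L) y); first exact: Giter.
apply: (agreeW (leqnSn m)); apply/agreeP.
by rewrite def_x size_mkseq; apply: eq_mkseq => i; rewrite iter_shiftE.
Qed.

Definition trace {L : choiceType} (y : nat -> infseq L) : infseq L :=
  fun j => y j 0%N.

Lemma trace_agree {L : choiceType} (y : nat -> infseq L) (m : nat -> nat) :
  (forall j, (m j <= m j.+1)%N) ->
  (forall j, agree (m j) (shift_map (y j)) (y j.+1)) ->
  forall j, agree (m j) (iter j (@shift_map L) (trace y)) (y j).
Proof.
move=> m_nd y_step j i lt_i; rewrite iter_shiftE.
have {lt_i}: (i <= m j)%N by apply: ltnW.
elim: i j => [|i IH] j lt_i; first by rewrite addn0.
rewrite addnS -addSn IH; last exact: leq_trans (ltnW lt_i) (m_nd j).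
by rewrite -y_step.
Qed.

Lemma injective_unbounded (f : nat -> nat) :
  injective f -> forall N, exists m, (N <= f m)%N.
Proof.
move=> f_inj N; apply: contrapT => /forallNP f_lt.
have lt_fN m : (f m < N)%N by rewrite ltnNge; apply/negP/f_lt.
have /leq_card : injective (fun m : 'I_N.+1 => Ordinal (lt_fN m)).
  by move=> a b [/f_inj/val_inj].
by rewrite !card_ord ltnn.
Qed.

Lemma dense_sequence {L : countType} (Z : set (infseq L)) : Z !=set0 ->
  exists2 z : nat -> infseq L, (forall k, Z (z k)) &
    forall a, Z a -> forall n N, exists2 k, (N <= k)%N & agree n a (z k).
Proof.
move=> [z0 Zz0].
have /choice[z zP] (k : nat) : exists z : infseq L, Z z /\
    forall a n, Z a -> pickle (mkseq a n) = k -> agree n a z.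
  have [[a [n [Za defk]]]|none] :=
      pselect (exists a n, Z a /\ pickle (mkseq (a : infseq L) n) = k).
    exists a; split=> // b p Zb; rewrite -defk => /(pcan_inj pickleK) eqba.
    move/(congr1 size): (eqba); rewrite !size_mkseq => eqpn; subst p.
    exact/agreeP.
  by exists z0; split=> // a n Za defk; case: none; exists a, n.
exists z => [k|a Za n N]; first by case: (zP k).
have [|m leN] := @injective_unbounded (fun m => pickle (mkseq a (n + m))) _ N.
  by move=> i j /(pcan_inj pickleK)/(congr1 size); rewrite !size_mkseq => /addnI.
exists (pickle (mkseq a (n + m))) => //.
apply: (agreeW (leq_addr m n)).
by case: (zP (pickle (mkseq a (n + m)))) => _; apply.
Qed.

Lemma chain_concatenation {R : realType} {L : choiceType} (Z : set (infseq L))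
    (z : nat -> infseq L) (M : nat) :
  internally_chain_transitive R Z -> (forall k, Z (z k)) ->
  exists (y : nat -> infseq L) (m : nat -> nat),
    [/\ forall j, Z (y j),
        forall j, (M <= m j <= m j.+1)%N,
        forall j, agree (m j) (shift_map (y j)) (y j.+1) &
        forall k, exists j, [/\ (k <= j)%N, (k <= m j)%N & y j = z k]].
Proof.
move=> Zict Zz.
have /choice[l /choice[c cP]] (k : nat) : exists l (c : nat -> infseq L),
    [/\ (0 < l)%N, c 0%N = z k, c l = z k.+1,
        forall i, (i <= l)%N -> Z (c i) &
        forall i, (i < l)%N -> agree (M + k)%N (shift_map (c i)) (c i.+1)].
  have [|l [c [l0 c0 cl Zc c_step]]] :=
      Zict _ _ (Zz k) (Zz k.+1) (2^-1 ^+ (M + k)).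
    by rewrite exprn_gt0 ?invr_gt0.
  by exists l, c; split=> // i /c_step/agree_seq_dist.
(* State [(k, i)] stands for the [i]-th point of the [k]-th chain. *)
pose next (s : nat * nat) :=
  if (s.2.+1 < l s.1)%N then (s.1, s.2.+1) else (s.1.+1, 0%N).
pose st j := iter j next (0%N, 0%N).
have stS j : st j.+1 = next (st j) by [].
have st_lt j : ((st j).2 < l (st j).1)%N.
  elim: j => [|j IH]; first by case: (cP 0%N).
  rewrite stS /next; case: ifP => //= _.
  by case: (cP (st j).1.+1).
exists (fun j => c (st j).1 (st j).2), (fun j => M + (st j).1)%N; split=> [j|j|j|k].
- by case: (cP (st j).1) => _ _ _ Zc _; apply/Zc/ltnW.
- rewrite leq_addr leq_add2l stS /next.
  by case: ifP => _ /=.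
- have [_ _ cl _ c_step] := cP (st j).1.
  have := c_step _ (st_lt j); rewrite stS /next.
  case: ifP => // nlt; have [_ -> _ _ _] := cP (st j).1.+1.
  suff -> : (st j).2.+1 = l (st j).1 by rewrite cl.
  by apply/eqP; rewrite eqn_leq st_lt leqNgt nlt.
- suff [j lekj stj] : exists2 j, (k <= j)%N & st j = (k, 0%N).
    exists j; rewrite stj lekj leq_addl; split=> //.
    by case: (cP k).
  elim: k => [|k [j lekj stj]]; first by exists 0%N.
  have [l0 _ _ _ _] := cP k.
  have along i : (i < l k)%N -> st (i + j)%N = (k, i).
    elim: i => [|i IH] lt_i; first by rewrite add0n.
    by rewrite addSn stS IH 1?ltnW // /next lt_i.
  exists (l k + j)%N; first by rewrite -add1n leq_add.
  by rewrite -(prednK l0) addSn stS along ?prednK // /next /= prednK // ltnn.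
Qed.

Theorem theorem16 (R : realType) (L : countType)
    (Gamma : set (infseq L)) (Z : set (infseq L)) :
  subshift Gamma ->
  bounded_type Gamma ->
  Z `<=` Gamma ->
  Z !=set0 ->
  closed Z ->
  internally_chain_transitive R Z ->
  exists x : infseq L,
    [/\ Gamma x,
        Z = omega_limit x &
        forall eps : R, 0 < eps ->
          exists N : nat, forall i : nat, (N <= i)%N ->
            seq_dist_set R (iter i (@shift_map L) x) Z < eps].
Proof.
move=> Gsub Gbt ZG Z0 Zcl Zict.
have [M Gloc] := bounded_type_local Gsub Gbt.
have [z Zz z_dense] := dense_sequence Z0.
have [y [m [Zy mP y_step y_hit]]] := chain_concatenation M Zict Zz.
have m_nd j : (m j <= m j.+1)%N by have /andP[] := mP j.
have m_homo : {homo m : i j / (i <= j)%N} by apply: homo_leq => //; apply: leq_trans.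
have xy := trace_agree m_nd y_step.
have m_cvg n : exists N, forall i, (N <= i)%N -> (n <= m i)%N.
  have [N [_ le_nm _]] := y_hit n; exists N => i /m_homo; exact: leq_trans.
exists (trace y); split.
- apply: Gloc => j; exists (y j); first exact/ZG.
  by apply: agreeW (xy j); have /andP[] := mP j.
- apply/seteqP; split=> [a Za N _|a xa].
    apply/closure_agreeP => n.
    have [k leNk ak] := z_dense a Za n (maxn N n).
    have [j [le_kj le_km yj]] := y_hit k.
    move: leNk; rewrite geq_max => /andP[leNk le_nk].
    exists (iter j (@shift_map L) (trace y)).
      by exists j => //; apply: leq_trans le_kj.
    apply: agree_trans ak _; rewrite -yj; apply: agree_sym.
    by apply: agreeW (xy j); apply: leq_trans le_km.
  apply: Zcl; apply/closure_agreeP => n; have [N leNm] := m_cvg n.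
  have /closure_agreeP/(_ n)[_ [i leNi <-] ax] := xa N I.
  by exists (y i) => //; apply: agree_trans ax (agreeW (leNm i leNi) (xy i)).
- move=> eps /half_expr_lt[n lt_n]; have [N leNm] := m_cvg n.
  exists N => i leNi; apply: le_lt_trans lt_n.
  apply: le_trans (seq_dist_set_le _ (Zy i)) _.
  exact/seq_dist_agree/(agreeW (leNm i leNi)).
Qed.
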